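(* Let $q\in(0,1)$. For $n\ge 2$ let $C(SU_q(n))$ be the $C^*$-compact quantum group with generators $0,1,u^n_{ij}$ ($1\le i,j\le n$) and comultiplication $\Delta_n$, and let $\theta_n: C(SU_q(n))\to C(SU_q(n-1))$ (for $n\geq 3$) be the surjective unital $*$-homomorphism with $\theta_n(u^n_{ij})=u^{n-1}_{ij}$ if $1\le i,j\le n-1$ and $\theta_n(u^n_{ij})=\delta_{ij}1$ otherwise, all as specified in the context. Then the maps $\Delta_n$ form a morphism of inverse systems $\{C(SU_q(n)),\theta_n\}\to\{C(SU_q(n))\hat{\otimes} C(SU_q(n)),\theta_n\hat{\otimes}\theta_n\}$, and the $\sigma$-$C^*$-algebra $$C(SU_q(\infty)):=\varprojlim_n C(SU_q(n)),$$ equipped with the comultiplication $\Delta:=\varprojlim_n\Delta_n$, is a $\sigma$-$C^*$-quantum group.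
   Context: Inverse limits are taken in the category of topological $*$-algebras and continuous $*$-homomorphisms. A pro $C^*$-algebra is such an inverse limit of $C^*$-algebras and $*$-homomorphisms; it is a $\sigma$-$C^*$-algebra if the directed set is countable, in which case one may write $A\cong\varprojlim_{n\in\mathbb N}A_n$. For $\sigma$-$C^*$-algebras $A\cong\varprojlim_n A_n$ and $B\cong\varprojlim_n B_n$, the tensor product is $A\hat{\otimes}B:=\varprojlim_n A_n\otimes_{\min}B_n$ (the minimal, i.e. spatial, tensor product; for $C^*$-algebras, $\hat\otimes=\otimes_{\min}$). A unital $\sigma$-$C^*$-algebra $A$ is called a $\sigma$-$C^*$-quantum group if there is a unital $*$-homomorphism $\Delta:A\to A\hat{\otimes}A$ such that $(\Delta\hat{\otimes}\mathrm{id})\Delta=(\mathrm{id}\hat{\otimes}\Delta)\Delta$ and such that the linear spaces $\Delta(A)(A\hat{\otimes}1)$ and $\Delta(A)(1\hat{\otimes}A)$ (the linear spans of the products $\Delta(a)(b\otimes 1)$, respectively $\Delta(a)(1\otimes b)$, $a,b\in A$) are dense in $A\hat{\otimes}A$. For $q\in(0,1)$, $C(SU_q(n))$ is the universal $C^*$-algebra generated by the $n^2+2$ elements $\{u^n_{ij}: i,j=1,\dots,n\}\cup\{0,1\}$ subject to the relations: (i) $0^*=0^2=0$, $1^*=1^2=1$, $01=0=10$, $1u^n_{ij}=u^n_{ij}1=u^n_{ij}$, $0u^n_{ij}=u^n_{ij}0=0$ for all $i,j$; (ii) $\sum_{k=1}^n u^n_{ik}(u^n_{jk})^*=\delta_{ij}1$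 and $\sum_{k=1}^n (u^n_{ki})^*u^n_{kj}=\delta_{ij}1$ for all $i,j$ (where $\delta_{ij}1$ is the generator $0$ if $i\neq j$); (iii) $\sum_{i_1=1}^n\cdots\sum_{i_n=1}^n E_{i_1i_2\cdots i_n}\,u^n_{j_1i_1}\cdots u^n_{j_ni_n}=E_{j_1j_2\cdots j_n}1$ for all $j_1,\dots,j_n\in\{1,\dots,n\}$, where $E_{i_1\cdots i_n}=0$ if $i_1,\dots,i_n$ are not distinct, and $E_{i_1\cdots i_n}=(-q)^{\ell(i_1,\dots,i_n)}$ otherwise, with $\ell(i_1,\dots,i_n)$ the number of inversed pairs (inversions) of the permutation $(i_1,\dots,i_n)$. It is a known fact that $C(SU_q(n))$ is a $C^*$-compact quantum group (a unital $C^*$-algebra $A$ with a unital $*$-homomorphism $\Delta_A:A\to A\hat{\otimes}A$ such that $(\Delta_A\hat{\otimes}\mathrm{id})\Delta_A=(\mathrm{id}\hat{\otimes}\Delta_A)\Delta_A$ and such that the linear spaces $\Delta_A(A)(A\hat{\otimes}1)$ and $\Delta_A(A)(1\hat{\otimes}A)$ are dense in $A\hat{\otimes}A$) with comultiplication $\Delta_n$ determined by $\Delta_n(0)=0\otimes 0$, $\Delta_n(1)=1\otimes 1$, $\Delta_n(u^n_{ij})=\sum_k u^n_{ik}\otimes u^n_{kj}$. The map $\theta_n$ is the $*$-homomorphism determined on generators by $\theta_n(0)=0$, $\theta_n(1)=1$, and the formula for $\theta_n(u^n_{ij})$ given in the claim. That the $\Delta_n$ form a morphism of inverse systems means $(\theta_n\hat{\otimes}\theta_n)\circ\Delta_n=\Delta_{n-1}\circ\theta_n$.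 *)

(* Defs.v *)
From HB Require Import structures.
From mathcomp Require Import all_boot all_order all_algebra.
From mathcomp Require Import complex.
From mathcomp Require Import all_classical reals topology normedtype.
From mathcomp Require Import ring.

Set Implicit Arguments.
Unset Strict Implicit.
Unset Printing Implicit Defensive.

Import Order.TTheory GRing.Theory Num.Theory Num.Def.
Import numFieldNormedType.Exports.
Local Open Scope classical_set_scope.
Local Open Scope ring_scope.
Local Open Scope complex_scope.

HB.mixin Record hasStar (R : realType) A & GRing.Algebra R[i] A := {
  star : A -> A;
  starK : involutive star;
  starD : forall a b : A, star (a + b) = star a + star b;
  starZ : forall (c : R[i]) (a : A), star (c *: a) = conjC c *: star a;
  starM : forall a b : A, star (a * b) = star b * star a
}.

#[short(type="starAlgType")]
HB.structure Definition StarAlgebra (R : realType) :=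
  {A of GRing.Algebra R[i] A & hasStar R A}.

HB.mixin Record isTopStar (R : realType) A
    & StarAlgebra R A & TopologicalLmodule R[i] A := {
  mul_continuous : continuous (fun p : A * A => p.1 * p.2);
  star_continuous : continuous (@star R A)
}.

#[short(type="topStarAlgType")]
HB.structure Definition TopStarAlgebra (R : realType) :=
  {A of StarAlgebra R A & TopologicalLmodule R[i] A & isTopStar R A}.

(* Unital C*-algebras. Hierarchy Builder cannot join ring structures with the
   library's normed modules (their only common substructure is numDomainType),
   hence the explicit real-valued norm; cnorm_nbhs says that the topology is
   the norm topology. *)
HB.mixin Record isCstar (R : realType) A & TopStarAlgebra R A := {
  cnorm : A -> R;
  cnormD : forall a b : A, cnorm (a + b) <= cnorm a + cnorm b;
  cnormZ : forall (c : R[i]) (a : A), cnorm (c *: a) = Normc.normc c * cnorm a;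
  cnorm_eq0 : forall a : A, cnorm a = 0 -> a = 0;
  cnormM : forall a b : A, cnorm (a * b) <= cnorm a * cnorm b;
  cnorm_star : forall a : A, cnorm (star a * a) = cnorm a ^+ 2;
  cnorm_nbhs : forall (a : A) (U : set A),
    nbhs a U <-> exists2 e : R, 0 < e & forall b, cnorm (b - a) < e -> U b;
  cnorm_complete : forall v : nat -> A,
    (forall e : R, 0 < e -> exists N, forall m n,
       (N <= m)%N -> (N <= n)%N -> cnorm (v m - v n) < e) ->
    exists l : A, v @ \oo --> l
}.

#[short(type="cstarAlgType")]
HB.structure Definition CstarAlgebra (R : realType) :=
  {A of TopStarAlgebra R A & isCstar R A}.

Section CnormTheory.
Context (R : realType) (A : cstarAlgType R).
Implicit Types (a b : A) (v w : nat -> A).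

Lemma cnorm0 : cnorm (0 : A) = 0.
Proof.
by rewrite -[X in cnorm X](scale0r (0 : A)) cnormZ Normc.normc0 mul0r.
Qed.

Lemma cnormN a : cnorm (- a) = cnorm a.
Proof.
by rewrite -scaleN1r cnormZ /Normc.normc /= oppr0 expr0n addr0 sqrrN expr1n
  sqrtr1 mul1r.
Qed.

Lemma cnorm_ge0 a : 0 <= cnorm a.
Proof.
have := cnormD a (- a); rewrite subrr cnorm0 cnormN -mulr2n pmulrn_lge0 //.
Qed.

Lemma cnormB a b : cnorm (a - b) = cnorm (b - a).
Proof. by rewrite -cnormN opprB. Qed.

Lemma cnorm_triangle a b c : cnorm (a - c) <= cnorm (a - b) + cnorm (b - c).
Proof. by rewrite -[a - c](subrKA b) cnormD. Qed.

Lemma cvg_cnorm v a : v @ \oo --> a <->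
  forall e : R, 0 < e -> exists N, forall n, (N <= n)%N -> cnorm (v n - a) < e.
Proof.
split=> [va e e0|va U].
  have : nbhs a [set b | cnorm (b - a) < e] by apply/cnorm_nbhs; exists e.
  by move=> /va [N _ Nv]; exists N => n /Nv.
move=> /cnorm_nbhs[e e0 eU]; have [N vN] := va e e0.
by exists N => // n /= Nn; apply: eU; apply: vN.
Qed.

Lemma cnorm_cvg_unique v a b : v @ \oo --> a -> v @ \oo --> b -> a = b.
Proof.
move=> /cvg_cnorm va /cvg_cnorm vb; apply/eqP; rewrite -subr_eq0.
apply/eqP/cnorm_eq0/eqP; rewrite eq_le cnorm_ge0 andbT.
apply/ler_addgt0Pr => e e0; rewrite add0r.
have e2 : 0 < e / 2 by rewrite divr_gt0.
have [N vN] := va _ e2; have [M vM] := vb _ e2.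
rewrite (le_trans (cnorm_triangle a (v (maxn N M)) b)) // [e]splitr.
by rewrite lerD ?ltW// ?[cnorm (a - _)]cnormB ?vN ?vM ?leq_maxl ?leq_maxr.
Qed.

Lemma dense_approx (D : set A) a (e : R) : dense D -> 0 < e ->
  exists2 b, D b & cnorm (b - a) < e.
Proof.
move=> dD e0; have : nbhs a [set b | cnorm (b - a) < e].
  by apply/cnorm_nbhs; exists e.
rewrite nbhsE => -[O [oO Oa] OU].
have [|b [Ob Db]] := dD O _ oO; first by exists a.
by exists b => //; apply: OU.
Qed.

End CnormTheory.

(* The Banach space underlying a C*-algebra, as a normed module of the library.
   It lies in the universe of the Hilbert spaces below, so that these are large
   enough for every C*-algebra to have a faithful representation. *)
Definition banach (R : realType) (A : cstarAlgType R) : Type := A.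

Section BanachInstance.
Context (R : realType) (A : cstarAlgType R).

HB.instance Definition _ := GRing.Lmodule.copy (banach A) (A : lmodType R[i]).

Let banach_norm (a : banach A) : R[i] := (cnorm (a : A))%:C.

Fact banach_normD a b : banach_norm (a + b) <= banach_norm a + banach_norm b.
Proof. by rewrite /banach_norm -rmorphD lecR cnormD. Qed.

Fact banach_normZ (c : R[i]) a : banach_norm (c *: a) = `|c| * banach_norm a.
Proof. by rewrite /banach_norm cnormZ rmorphM; case: c. Qed.

Fact banach_norm_eq0 a : banach_norm a = 0 -> a = 0.
Proof. by case=> /cnorm_eq0. Qed.

HB.instance Definition _ := Lmodule_isNormed.Build R[i] (banach A)
  banach_normD banach_normZ banach_norm_eq0.

Lemma banach_nbhsE (a : A) : nbhs (a : banach A) = nbhs a.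
Proof.
apply/seteqP; split => U.
  move=> /nbhs_ballP[e e0 eU]; apply/cnorm_nbhs.
  have eR : (complex.Re e)%:C = e by rewrite RRe_real // gtr0_real.
  exists (complex.Re e); first by rewrite -ltcR eR.
  move=> b; rewrite -ltcR eR => ab; apply: eU; rewrite -ball_normE /ball_ /=.
  by rewrite distrC.
move=> /cnorm_nbhs[e e0 eU]; apply/nbhs_ballP; exists e%:C => /=.
  by rewrite ltcR.
by move=> b; rewrite -ball_normE /ball_ /= distrC ltcR => /eU.
Qed.

Fact banach_complete (F : set_system (banach A)) :
  ProperFilter F -> cauchy F -> cvg F.
Proof.
move=> FF /cauchyP Fc.
have h n : exists x : A,
    F [set y : banach A | cnorm ((y : A) - x) < n.+1%:R^-1].
  have [|x Fx] := Fc (n.+1%:R^-1)%:C; first by rewrite ltcR invr_gt0 ltr0n.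
  exists x; apply: filterS Fx => y; rewrite -ball_normE /ball_ /= distrC.
  by rewrite ltcR.
have [v vP] := choice h.
have small (e : R) : 0 < e -> exists N, forall n, (N <= n)%N -> n.+1%:R^-1 < e.
  move=> e0; exists (Num.bound e^-1) => n Nn.
  rewrite -[ltRHS]invrK ltf_pV2 ?posrE ?invr_gt0 ?ltr0n//.
  have /archi_boundP/lt_le_trans : 0 <= e^-1 by rewrite invr_ge0 ltW.
  by apply; rewrite ler_nat ltnW.
have [l vl] : exists l : A, v @ \oo --> l.
  apply: cnorm_complete => e e0.
  have [|N Ne] := small (e / 2); first by rewrite divr_gt0.
  exists N => m n Nm Nn.
  have [y [ym yn]] := filter_ex (filterI (vP m) (vP n)).
  rewrite (le_lt_trans (cnorm_triangle _ (y : A) _)) // [e]splitr ltrD //.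
    by rewrite cnormB (lt_trans ym) ?Ne.
  by rewrite (lt_trans yn) ?Ne.
apply/cvg_ex; exists l; rewrite /cvg_to /= banach_nbhsE => U.
move=> /cnorm_nbhs[e e0 eU].
have e2 : 0 < e / 2 by rewrite divr_gt0.
have [N Ne] := small _ e2; have /cvg_cnorm/(_ _ e2)[M Ml] := vl.
apply: filterS (vP (maxn N M)) => y yv; apply: eU.
rewrite (le_lt_trans (cnorm_triangle _ (v (maxn N M)) _)) // [e]splitr ltrD //.
  by rewrite (lt_trans yv) ?Ne ?leq_maxl.
by rewrite Ml ?leq_maxr.
Qed.

HB.instance Definition _ := Uniform_isComplete.Build (banach A) banach_complete.

End BanachInstance.

(* Continuous *-homomorphisms, not necessarily unital. Between C*-algebras
   continuity is automatic. *)
Record starHom (R : realType) (A B : topStarAlgType R) := StarHom {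
  hom_fun :> A -> B;
  hom_linear : forall (c : R[i]) (a b : A),
    hom_fun (c *: a + b) = c *: hom_fun a + hom_fun b;
  hom_mul : forall a b : A, hom_fun (a * b) = hom_fun a * hom_fun b;
  hom_star : forall a : A, hom_fun (star a) = star (hom_fun a);
  hom_continuous : continuous hom_fun
}.

Record hilbert (R : realType) := Hilbert {
  hsort :> completeNormedModType R[i];
  inner : {dot hsort for conjC};
  inner_norm : forall x : hsort, `|x| ^+ 2 = inner x x
}.

Record starRep (R : realType) (A : cstarAlgType R) (H : hilbert R) := StarRep {
  rep_op :> A -> H -> H;
  rep_linear : forall (c : R[i]) (a b : A) (x : H),
    rep_op (c *: a + b) x = c *: rep_op a x + rep_op b x;
  rep_op_linear : forall (a : A) (c : R[i]) (x y : H),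
    rep_op a (c *: x + y) = c *: rep_op a x + rep_op a y;
  rep_op_continuous : forall a : A, continuous (rep_op a);
  rep_mul : forall (a b : A) (x : H), rep_op (a * b) x = rep_op a (rep_op b x);
  rep_star : forall (a : A) (x y : H),
    inner H (rep_op (star a) x) y = inner H x (rep_op a y)
}.

(* The squared norm of \sum_j x_j (x) y_j in the Hilbert space H (x) K, where
   <x (x) y, x' (x) y'> = <x, x'> <y, y'>; t is the sequence of (x_j, y_j). *)
Definition hilbert_tensor_sqnorm (R : realType) (H K : hilbert R)
    (t : seq (H * K)) : R[i] :=
  \sum_(p <- t) \sum_(r <- t) inner H p.1 r.1 * inner K p.2 r.2.

(* The vector (\sum_i pi(a_i) (x) rho(b_i)) (\sum_j x_j (x) y_j). *)
Definition rep_tensor_apply (R : realType) (A B : cstarAlgType R)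
    (H K : hilbert R) (pi : starRep A H) (rho : starRep B K)
    (s : seq (A * B)) (t : seq (H * K)) : seq (H * K) :=
  [seq (pi p.1 r.1, rho p.2 r.2) | p <- s, r <- t].

(* || \sum_i pi(a_i) (x) rho(b_i) || <= c on H (x) K, for all *-representations
   pi of A on H and rho of B on K (it is enough to test the operator on the
   algebraic tensor product, which is dense). *)
Definition spatial_le (R : realType) (A B : cstarAlgType R)
    (s : seq (A * B)) (c : R) : Prop :=
  forall (H K : hilbert R) (pi : starRep A H) (rho : starRep B K)
    (t : seq (H * K)),
    hilbert_tensor_sqnorm (rep_tensor_apply pi rho s t)
      <= (c ^+ 2)%:C * hilbert_tensor_sqnorm t.

(* The minimal (spatial) tensor product of A and B: a C*-algebra with a dense
   copy of the algebraic tensor product on which the norm is the spatial norm,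
     ||\sum_i a_i (x) b_i|| = sup_(pi, rho) ||\sum_i pi(a_i) (x) rho(b_i)||.
   This is the completion of the algebraic tensor product, and determines the
   C*-algebra up to a unique isomorphism. *)
Record spatialTensor (R : realType) (A B : cstarAlgType R) := SpatialTensor {
  tensor_alg :> cstarAlgType R;
  tens : A -> B -> tensor_alg;
  tens_linearl : forall (b : B) (c : R[i]) (a a' : A),
    tens (c *: a + a') b = c *: tens a b + tens a' b;
  tens_linearr : forall (a : A) (c : R[i]) (b b' : B),
    tens a (c *: b + b') = c *: tens a b + tens a b';
  tens1 : tens 1 1 = 1;
  tensM : forall (a a' : A) (b b' : B),
    tens a b * tens a' b' = tens (a * a') (b * b');
  tens_star : forall (a : A) (b : B), star (tens a b) = tens (star a) (star b);
  tens_norm : forall (s : seq (A * B)) (c : R), 0 <= c ->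
    (cnorm (\sum_(p <- s) tens p.1 p.2) <= c <-> spatial_le s c);
  tens_dense : dense [set x | exists s : seq (A * B),
    x = \sum_(p <- s) tens p.1 p.2]
}.

(* A choice of the minimal tensor product of any two unital C*-algebras. *)
Definition minTensor (R : realType) :=
  forall A B : cstarAlgType R, spatialTensor A B.

Section HomTheory.
Context (R : realType) (A B : topStarAlgType R) (f : starHom A B).

Lemma hom0 : f 0 = 0.
Proof.
have := hom_linear f 1 0 0; rewrite !scale1r addr0 => /eqP.
by rewrite -subr_eq0 opprD addNKr oppr_eq0 => /eqP.
Qed.

Lemma homD a b : f (a + b) = f a + f b.
Proof. by have := hom_linear f 1 a b; rewrite !scale1r. Qed.

Lemma homZ c a : f (c *: a) = c *: f a.
Proof. by have := hom_linear f c a 0; rewrite hom0 !addr0. Qed.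

Lemma homN a : f (- a) = - f a.
Proof. by rewrite -scaleN1r homZ scaleN1r. Qed.

Lemma homB a b : f (a - b) = f a - f b.
Proof. by rewrite homD homN. Qed.

End HomTheory.

(* Inverse systems A_0 <- A_1 <- A_2 <- ... of unital C*-algebras and unital
   *-homomorphisms, i.e. presentations of unital sigma-C*-algebras. *)
Record invSystem (R : realType) := InvSystem {
  sys_obj :> nat -> cstarAlgType R;
  sys_map : forall n, starHom (sys_obj n.+1) (sys_obj n);
  sys_map1 : forall n, sys_map n 1 = 1
}.

(* The sigma-C*-algebra presented by S: the coherent sequences, with the
   componentwise operations and the topology of the product. *)
Record lim_alg (R : realType) (S : invSystem R) := LimAlg {
  lim_at :> forall n, S n;
  lim_atP : forall n, sys_map S n (lim_at n.+1) = lim_at n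
}.

Lemma lim_alg_inj (R : realType) (S : invSystem R) (x y : lim_alg S) :
  (forall n, x n = y n) -> x = y.
Proof.
case: x y => [x xP] [y yP] /= xy.
have {}xy : x = y by apply: functional_extensionality_dep.
by subst y; congr LimAlg; exact: Prop_irrelevance.
Qed.

HB.instance Definition _ (R : realType) (S : invSystem R) :=
  gen_eqMixin (lim_alg S).
HB.instance Definition _ (R : realType) (S : invSystem R) :=
  gen_choiceMixin (lim_alg S).

Section LimAlgebra.
Context (R : realType) (S : invSystem R).
Implicit Types (x y z : lim_alg S) (c : R[i]).

Fact lim_zeroP n : sys_map S n 0 = 0 :> S n.
Proof. exact: hom0. Qed.
Fact lim_addP x y n : sys_map S n (x n.+1 + y n.+1) = x n + y n.
Proof. by rewrite homD !lim_atP. Qed.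
Fact lim_oppP x n : sys_map S n (- x n.+1) = - x n.
Proof. by rewrite homN !lim_atP. Qed.
Fact lim_mulP x y n : sys_map S n (x n.+1 * y n.+1) = x n * y n.
Proof. by rewrite hom_mul !lim_atP. Qed.
Fact lim_scaleP c x n : sys_map S n (c *: x n.+1) = c *: x n.
Proof. by rewrite homZ !lim_atP. Qed.
Fact lim_starP x n : sys_map S n (star (x n.+1)) = star (x n).
Proof. by rewrite hom_star !lim_atP. Qed.

Definition lim_zero : lim_alg S := @LimAlg R S (fun n => 0) lim_zeroP.
Definition lim_one : lim_alg S := @LimAlg R S (fun n => 1) (@sys_map1 R S).
Definition lim_add x y := @LimAlg R S (fun n => x n + y n) (lim_addP x y).
Definition lim_opp x := @LimAlg R S (fun n => - x n) (lim_oppP x).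
Definition lim_mul x y := @LimAlg R S (fun n => x n * y n) (lim_mulP x y).
Definition lim_scale c x := @LimAlg R S (fun n => c *: x n) (lim_scaleP c x).
Definition lim_star x := @LimAlg R S (fun n => star (x n)) (lim_starP x).

Fact lim_addA : associative lim_add.
Proof. by move=> x y z; apply: lim_alg_inj => n /=; rewrite addrA. Qed.
Fact lim_addC : commutative lim_add.
Proof. by move=> x y; apply: lim_alg_inj => n /=; rewrite addrC. Qed.
Fact lim_add0 : left_id lim_zero lim_add.
Proof. by move=> x; apply: lim_alg_inj => n /=; rewrite add0r. Qed.
Fact lim_addN : left_inverse lim_zero lim_opp lim_add.
Proof. by move=> x; apply: lim_alg_inj => n /=; rewrite addNr. Qed.

HB.instance Definition _ := GRing.isZmodule.Build (lim_alg S)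
  lim_addA lim_addC lim_add0 lim_addN.

Fact lim_mulA : associative lim_mul.
Proof. by move=> x y z; apply: lim_alg_inj => n /=; rewrite mulrA. Qed.
Fact lim_mul1 : left_id lim_one lim_mul.
Proof. by move=> x; apply: lim_alg_inj => n /=; rewrite mul1r. Qed.
Fact lim_mulr1 : right_id lim_one lim_mul.
Proof. by move=> x; apply: lim_alg_inj => n /=; rewrite mulr1. Qed.
Fact lim_mulDl : left_distributive lim_mul lim_add.
Proof. by move=> x y z; apply: lim_alg_inj => n /=; rewrite mulrDl. Qed.
Fact lim_mulDr : right_distributive lim_mul lim_add.
Proof. by move=> x y z; apply: lim_alg_inj => n /=; rewrite mulrDr. Qed.
Fact lim_one_neq0 : lim_one != 0.
Proof.
apply/eqP => /(congr1 (fun x : lim_alg S => x 0%N)) /= /eqP.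
by rewrite oner_eq0.
Qed.

HB.instance Definition _ := GRing.Zmodule_isNzRing.Build (lim_alg S)
  lim_mulA lim_mul1 lim_mulr1 lim_mulDl lim_mulDr lim_one_neq0.

Fact lim_scaleA c d x : lim_scale c (lim_scale d x) = lim_scale (c * d) x.
Proof. by apply: lim_alg_inj => n /=; rewrite scalerA. Qed.
Fact lim_scale1 : left_id 1 lim_scale.
Proof. by move=> x; apply: lim_alg_inj => n /=; rewrite scale1r. Qed.
Fact lim_scaleDr : right_distributive lim_scale +%R.
Proof. by move=> c x y; apply: lim_alg_inj => n /=; rewrite scalerDr. Qed.
Fact lim_scaleDl x : {morph lim_scale^~ x : c d / c + d}.
Proof. by move=> c d; apply: lim_alg_inj => n /=; rewrite scalerDl. Qed.

HB.instance Definition _ := GRing.Zmodule_isLmodule.Build R[i] (lim_alg S)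
  lim_scaleA lim_scale1 lim_scaleDr lim_scaleDl.

Fact lim_scaleAl c x y : c *: (x * y) = (c *: x) * y.
Proof. by apply: lim_alg_inj => n /=; rewrite scalerAl. Qed.
Fact lim_scaleAr c x y : c *: (x * y) = x * (c *: y).
Proof. by apply: lim_alg_inj => n /=; rewrite scalerAr. Qed.

HB.instance Definition _ := GRing.Lmodule_isLalgebra.Build R[i] (lim_alg S)
  lim_scaleAl.
HB.instance Definition _ := GRing.Lalgebra_isAlgebra.Build R[i] (lim_alg S)
  lim_scaleAr.

Fact lim_starK : involutive lim_star.
Proof. by move=> x; apply: lim_alg_inj => n /=; rewrite starK. Qed.
Fact lim_starD x y : lim_star (x + y) = lim_star x + lim_star y.
Proof. by apply: lim_alg_inj => n /=; rewrite starD. Qed.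
Fact lim_starZ c x : lim_star (c *: x) = conjC c *: lim_star x.
Proof. by apply: lim_alg_inj => n /=; rewrite starZ. Qed.
Fact lim_starM x y : lim_star (x * y) = lim_star y * lim_star x.
Proof. by apply: lim_alg_inj => n /=; rewrite starM. Qed.

HB.instance Definition _ := hasStar.Build R (lim_alg S)
  lim_starK lim_starD lim_starZ lim_starM.

HB.instance Definition _ := Topological.copy (lim_alg S)
  (initial_topology (fun x => lim_at x : prod_topology (fun n => S n))).

Lemma lim_at_continuous n : continuous (fun x => x n : S n).
Proof.
move=> x; apply: (@continuous_comp _ _ _
  (@lim_at R S : lim_alg S -> prod_topology (fun n => S n)) (fun f => f n)).
  exact: initial_continuous.
exact: (@proj_continuous _ (fun n => S n)).
Qed.

Lemma continuous_lim (U : topologicalType) (f : U -> lim_alg S) :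
  (forall n, continuous (fun u => f u n : S n)) -> continuous f.
Proof.
move=> cf; pose w := fun x => lim_at x : prod_topology (fun n => S n).
apply: (@continuous_comp_initial _ _ _ w) => u.
apply/cvg_sup => n.
by have := @continuous_comp_initial _ _ _
  (fun g : prod_topology (fun n => S n) => g n) (w \o f) (cf n) u.
Qed.

Let fst_at n : continuous (fun p : lim_alg S * lim_alg S => p.1 n : S n).
Proof.
by move=> p; apply: (@continuous_comp _ _ _ fst (fun x : lim_alg S => x n));
  [exact: cvg_fst|exact: lim_at_continuous].
Qed.

Let snd_at n : continuous (fun p : lim_alg S * lim_alg S => p.2 n : S n).
Proof.
by move=> p; apply: (@continuous_comp _ _ _ snd (fun x : lim_alg S => x n));
  [exact: cvg_snd|exact: lim_at_continuous].
Qed.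

Fact lim_sub_continuous :
  continuous (fun p : lim_alg S * lim_alg S => p.1 - p.2).
Proof.
apply: continuous_lim => n /= p.
apply: (@continuous2_cvg _ _ _ _ _ _ _ _
  (fun a b : S n => a - b) (p.1 n) (p.2 n)).
- exact: (@sub_continuous _ (p.1 n, p.2 n)).
- exact: fst_at.
- exact: snd_at.
Qed.

HB.instance Definition _ :=
  PreTopologicalNmodule_isTopologicalZmodule.Build (lim_alg S)
    lim_sub_continuous.

Fact lim_scale_continuous :
  continuous (fun p : R[i]^o * lim_alg S => p.1 *: p.2).
Proof.
apply: continuous_lim => n /= p.
apply: (@continuous2_cvg _ _ _ _ _ _ _ _
  (fun (a : R[i]^o) (b : S n) => a *: b) p.1 (p.2 n)).
- exact: (@scale_continuous _ _ (p.1, p.2 n)).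
- exact: cvg_fst.
- by apply: (@continuous_comp _ _ _ snd (fun x : lim_alg S => x n));
    [exact: cvg_snd|exact: lim_at_continuous].
Qed.

HB.instance Definition _ :=
  TopologicalNmodule_isTopologicalLmodule.Build R[i] (lim_alg S)
    lim_scale_continuous.

Fact lim_mul_continuous :
  continuous (fun p : lim_alg S * lim_alg S => p.1 * p.2).
Proof.
apply: continuous_lim => n /= p.
apply: (@continuous2_cvg _ _ _ _ _ _ _ _
  (fun a b : S n => a * b) (p.1 n) (p.2 n)).
- exact: (@mul_continuous _ _ (p.1 n, p.2 n)).
- exact: fst_at.
- exact: snd_at.
Qed.

Fact lim_star_continuous : continuous (@star R (lim_alg S)).
Proof.
apply: continuous_lim => n /= p.
apply: (@continuous_comp _ _ _ (fun x : lim_alg S => x n) (@star R (S n))).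
  exact: lim_at_continuous.
exact: star_continuous.
Qed.

HB.instance Definition _ := isTopStar.Build R (lim_alg S)
  lim_mul_continuous lim_star_continuous.

End LimAlgebra.

Section TensorMap.
Context (R : realType) (A B A' B' : cstarAlgType R).
Context (T : spatialTensor A B) (T' : spatialTensor A' B').
Context (f : starHom A A') (g : starHom B B').

Let phi (s : seq (A * B)) : T := \sum_(p <- s) tens T p.1 p.2.
Let psi (s : seq (A * B)) : T' := \sum_(p <- s) tens T' (f p.1) (g p.2).

Let tens0r (C D : cstarAlgType R) (X : spatialTensor C D) (d : D) :
  tens X 0 d = 0.
Proof. by have := tens_linearl X d (-1) 0 0; rewrite !scaleN1r !addNr. Qed.

Let tensZ (C D : cstarAlgType R) (X : spatialTensor C D) k (c : C) (d : D) :
  tens X (k *: c) d = k *: tens X c d.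
Proof. by have := tens_linearl X d k c 0; rewrite tens0r !addr0. Qed.

Definition rep_pullback (C D : cstarAlgType R) (h : starHom C D)
  (H : hilbert R) (pi : starRep D H) : starRep C H.
Proof.
refine (@StarRep R C H (fun c => pi (h c)) _ _ _ _ _).
- by move=> k a b x; rewrite hom_linear rep_linear.
- by move=> *; rewrite rep_op_linear.
- by move=> *; exact: rep_op_continuous.
- by move=> *; rewrite hom_mul rep_mul.
- by move=> *; rewrite hom_star rep_star.
Defined.

Let psi_le s : cnorm (psi s) <= cnorm (phi s).
Proof.
have -> : psi s = \sum_(p <- [seq (f p.1, g p.2) | p <- s]) tens T' p.1 p.2.
  by rewrite big_map.
apply/tens_norm; first exact: cnorm_ge0.
move=> H K pi rho t.
have /(tens_norm T) : cnorm (phi s) <= cnorm (phi s) by [].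
move=> /(_ (cnorm_ge0 _)) /(_ H K (rep_pullback f pi) (rep_pullback g rho) t).
congr (hilbert_tensor_sqnorm _ <= _).
by rewrite /rep_tensor_apply allpairs_mapl.
Qed.


Let scl k (s : seq (A * B)) := [seq (k *: p.1, p.2) | p <- s].
Let mul (s t : seq (A * B)) := [seq (p.1 * r.1, p.2 * r.2) | p <- s, r <- t].
Let str (s : seq (A * B)) := [seq (star p.1, star p.2) | p <- s].

Let phi_lin k s t : phi (scl k s ++ t) = k *: phi s + phi t.
Proof.
rewrite /phi big_cat big_map /= scaler_sumr; congr (_ + _).
by apply: eq_bigr => p _; rewrite tensZ.
Qed.

Let psi_lin k s t : psi (scl k s ++ t) = k *: psi s + psi t.
Proof.
rewrite /psi big_cat big_map /= scaler_sumr; congr (_ + _).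
by apply: eq_bigr => p _; rewrite homZ tensZ.
Qed.

Let phi_mul s t : phi (mul s t) = phi s * phi t.
Proof.
rewrite /phi big_allpairs_dep /= mulr_suml; apply: eq_bigr => p _.
by rewrite mulr_sumr; apply: eq_bigr => r _; rewrite tensM.
Qed.

Let psi_mul s t : psi (mul s t) = psi s * psi t.
Proof.
rewrite /psi big_allpairs_dep /= mulr_suml; apply: eq_bigr => p _.
by rewrite mulr_sumr; apply: eq_bigr => r _; rewrite tensM !hom_mul.
Qed.

Let star_sum (C : cstarAlgType R) (I : Type) (r : seq I) (F : I -> C) :
  star (\sum_(i <- r) F i) = \sum_(i <- r) star (F i).
Proof.
apply: (big_morph (@star R C)); first exact: starD.
by apply: (@addrI _ (star 0)); rewrite -starD !addr0.
Qed.

Let phi_str s : phi (str s) = star (phi s).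
Proof.
by rewrite /phi big_map star_sum; apply: eq_bigr => p _; rewrite tens_star.
Qed.

Let psi_str s : psi (str s) = star (psi s).
Proof.
rewrite /psi big_map star_sum; apply: eq_bigr => p _.
by rewrite tens_star !hom_star.
Qed.

Let psi_leB s t : cnorm (psi s - psi t) <= cnorm (phi s - phi t).
Proof.
have := psi_le (scl (-1) t ++ s).
by rewrite phi_lin psi_lin !scaleN1r ![- _ + _]addrC.
Qed.

Let psi_cvg (s : nat -> seq (A * B)) (t : T) : phi \o s @ \oo --> t ->
  exists y : T', psi \o s @ \oo --> y.
Proof.
move=> /cvg_cnorm st; apply: cnorm_complete => e e0.
have [|N sN] := st (e / 2); first by rewrite divr_gt0.
exists N => m n Nm Nn; rewrite (le_lt_trans (psi_leB _ _)) //.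
rewrite (le_lt_trans (cnorm_triangle _ t _)) // [e]splitr ltrD //.
  exact: sN.
by rewrite cnormB; exact: sN.
Qed.

Let approx (t : T) : exists s : nat -> seq (A * B), phi \o s @ \oo --> t.
Proof.
have h n : exists s, cnorm (phi s - t) < n.+1%:R^-1.
  have [|_ [s ->] st] :=
    dense_approx t (@tens_dense _ _ _ T) (_ : 0 < n.+1%:R^-1).
    by rewrite invr_gt0 ltr0n.
  by exists s.
have [s sP] := choice h; exists s; apply/cvg_cnorm => e e0.
have [N Ne] : exists N, N.+1%:R^-1 < e.
  exists (Num.bound e^-1).
  rewrite -[ltRHS]invrK ltf_pV2 ?posrE ?invr_gt0 ?ltr0n//.
  have /archi_boundP/lt_trans : 0 <= e^-1 by rewrite invr_ge0 ltW.
  by apply; rewrite ltr_nat.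
exists N => n Nn; rewrite (lt_trans (sP n)) // (le_lt_trans _ Ne) //.
by rewrite lef_pV2 ?posrE ?ltr0n // ler_nat ltnS.
Qed.

Let graph (t : T) := projT1 (cid (approx t)).
Let graphP (t : T) : phi \o graph t @ \oo --> t.
Proof. exact: projT2 (cid (approx t)). Qed.
Let F (t : T) : T' := projT1 (cid (@psi_cvg _ _ (@graphP t))).
Let FP t : psi \o graph t @ \oo --> F t.
Proof. exact: projT2 (cid (@psi_cvg _ _ (@graphP t))). Qed.

Let F_cvg (s : nat -> seq (A * B)) (t : T) :
  phi \o s @ \oo --> t -> psi \o s @ \oo --> F t.
Proof.
move=> /cvg_cnorm st; have /cvg_cnorm gt := @graphP t.
have /cvg_cnorm Ft := @FP t; apply/cvg_cnorm => e e0.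
have e3 : 0 < e / 3 by rewrite divr_gt0.
have [N1 sN] := st _ e3; have [N2 gN] := gt _ e3; have [N3 FN] := Ft _ e3.
exists (maxn N1 (maxn N2 N3)) => n; rewrite !geq_max => /and3P[n1 n2 n3].
rewrite (le_lt_trans (cnorm_triangle _ (psi (graph t n)) _)) //=.
have -> : e = (e / 3 + e / 3) + e / 3 by field.
rewrite ltrD ?FN // (le_lt_trans (psi_leB _ _)) //.
rewrite (le_lt_trans (cnorm_triangle _ t _)) // ltrD //; first exact: sN.
by rewrite cnormB; exact: gN.
Qed.

Let F_uniq (s : nat -> seq (A * B)) (t : T) (y : T') :
  phi \o s @ \oo --> t -> psi \o s @ \oo --> y -> F t = y.
Proof. by move=> /F_cvg sF /(cnorm_cvg_unique sF). Qed.

Let F_phi s : F (phi s) = psi s.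
Proof. by apply: (@F_uniq (fun=> s)); exact: cvg_cst. Qed.

Let cvg_lin (C : cstarAlgType R) k (v w : nat -> C) (a b : C) :
  v @ \oo --> a -> w @ \oo --> b ->
  (fun n => k *: v n + w n) @ \oo --> k *: a + b.
Proof.
move=> va wb; apply: (@continuous2_cvg _ _ _ _ _ _ _ _ (fun a b : C => a + b)).
- exact: (@add_continuous _ (k *: a, b)).
- apply: (@continuous2_cvg _ _ _ _ _ _ _ _
    (fun (k : R[i]^o) (b : C) => k *: b)).
  + exact: (@scale_continuous _ _ (k : R[i]^o, a)).
  + exact: cvg_cst.
  + exact: va.
- exact: wb.
Qed.

Let cvg_mul (C : cstarAlgType R) (v w : nat -> C) (a b : C) :
  v @ \oo --> a -> w @ \oo --> b -> (fun n => v n * w n) @ \oo --> a * b.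
Proof.
move=> va wb; apply: (@continuous2_cvg _ _ _ _ _ _ _ _ (fun a b : C => a * b)).
- exact: (@mul_continuous _ _ (a, b)).
- exact: va.
- exact: wb.
Qed.

Let F_linear k t t' : F (k *: t + t') = k *: F t + F t'.
Proof.
apply: (@F_uniq (fun n => scl k (graph t n) ++ graph t' n)).
  rewrite (_ : _ \o _ = fun n => k *: phi (graph t n) + phi (graph t' n)).
    by apply: cvg_lin; exact: graphP.
  by apply/funext => n; exact: phi_lin.
rewrite (_ : _ \o _ = fun n => k *: psi (graph t n) + psi (graph t' n)).
  by apply: cvg_lin; exact: FP.
by apply/funext => n; exact: psi_lin.
Qed.

Let F_mul t t' : F (t * t') = F t * F t'.
Proof.
apply: (@F_uniq (fun n => mul (graph t n) (graph t' n))).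
  rewrite (_ : _ \o _ = fun n => phi (graph t n) * phi (graph t' n)).
    by apply: cvg_mul; exact: graphP.
  by apply/funext => n; exact: phi_mul.
rewrite (_ : _ \o _ = fun n => psi (graph t n) * psi (graph t' n)).
  by apply: cvg_mul; exact: FP.
by apply/funext => n; exact: psi_mul.
Qed.

Let F_star t : F (star t) = star (F t).
Proof.
apply: (@F_uniq (fun n => str (graph t n))).
  rewrite (_ : _ \o _ = @star R T \o (phi \o graph t)).
    by apply: continuous_cvg; [exact: star_continuous|exact: graphP].
  by apply/funext => n; exact: phi_str.
rewrite (_ : _ \o _ = @star R T' \o (psi \o graph t)).
  by apply: continuous_cvg; [exact: star_continuous|exact: FP].
by apply/funext => n; exact: psi_str.
Qed.

Let F_le t : cnorm (F t) <= cnorm t.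
Proof.
have /cvg_cnorm gt := @graphP t; have /cvg_cnorm Ft := @FP t.
apply/ler_addgt0Pr => e e0; have e2 : 0 < e / 2 by rewrite divr_gt0.
have [N gN] := gt _ e2; have [M FM] := Ft _ e2.
set n := maxn N M; have /gN gn := leq_maxl N M; have /FM Fn := leq_maxr N M.
have h1 : cnorm (F t) <= cnorm (psi (graph t n)) + e / 2.
  have := cnormD (psi (graph t n)) (F t - psi (graph t n)).
  rewrite addrC subrK => /le_trans; apply; rewrite lerD2l cnormB; exact: ltW.
have h2 : cnorm (phi (graph t n)) <= cnorm t + e / 2.
  have := cnormD t (phi (graph t n) - t).
  rewrite addrC subrK => /le_trans; apply; rewrite lerD2l; exact: ltW.
rewrite (le_trans h1) // [e in leRHS]splitr addrA lerD2r.
exact: le_trans (psi_le _) h2.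
Qed.

Let F_continuous : continuous F.
Proof.
move=> t U /cnorm_nbhs[e e0 eU]; apply/cnorm_nbhs; exists e => // t' t't.
apply: eU; apply: le_lt_trans t't.
have -> : F t' - F t = F (t' - t).
  by have := F_linear (-1) t t'; rewrite !scaleN1r ![- _ + _]addrC => ->.
exact: F_le.
Qed.

Lemma tensor_map_exists : exists F : starHom T T',
  forall a b, F (tens T a b) = tens T' (f a) (g b).
Proof.
exists (StarHom F_linear F_mul F_star F_continuous) => a b /=.
by have := F_phi [:: (a, b)]; rewrite /phi /psi !big_seq1.
Qed.

(* The *-homomorphism f (x) g. *)
Definition tensor_map : starHom T T' := projT1 (cid tensor_map_exists).

Lemma tensor_mapE a b : tensor_map (tens T a b) = tens T' (f a) (g b).
Proof. exact: projT2 (cid tensor_map_exists) a b. Qed.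

Lemma tensor_map1 : f 1 = 1 -> g 1 = 1 -> tensor_map 1 = 1.
Proof. by move=> f1 g1; rewrite -(tens1 T) tensor_mapE f1 g1 tens1. Qed.

End TensorMap.

(* The system {A_n (x) B_n}, whose limit is the tensor product of lim A_n and
   lim B_n. *)
Definition tensor_sys (R : realType) (T : minTensor R) (S S' : invSystem R) :
    invSystem R :=
  @InvSystem R (fun n => T (S n) (S' n))
    (fun n => tensor_map (T (S n.+1) (S' n.+1)) (T (S n) (S' n))
                (sys_map S n) (sys_map S' n))
    (fun n => tensor_map1 _ _ (sys_map1 S n) (sys_map1 S' n)).

Fact lim_tensP (R : realType) (T : minTensor R) (S S' : invSystem R)
    (a : lim_alg S) (b : lim_alg S') (n : nat) :
  sys_map (tensor_sys T S S') n (tens (T _ _) (a n.+1) (b n.+1))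
    = tens (T _ _) (a n) (b n).
Proof. by rewrite /= tensor_mapE !lim_atP. Qed.

(* a (x) b = (a_n (x) b_n)_n. *)
Definition lim_tens (R : realType) (T : minTensor R) (S S' : invSystem R)
    (a : lim_alg S) (b : lim_alg S') : lim_alg (tensor_sys T S S') :=
  LimAlg (lim_tensP T a b).

Definition sys_morphism (R : realType) (S S' : invSystem R)
    (d : forall n, starHom (S n) (S' n)) : Prop :=
  forall (n : nat) (x : S n.+1), sys_map S' n (d n.+1 x) = d n (sys_map S n x).

Section LimMap.
Context (R : realType) (S S' : invSystem R).
Context (d : forall n, starHom (S n) (S' n)) (hd : sys_morphism d).

Fact lim_map_subproof (x : lim_alg S) n :
  sys_map S' n (d n.+1 (x n.+1)) = d n (x n).
Proof. by rewrite hd lim_atP. Qed.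

Definition lim_map_fun (x : lim_alg S) : lim_alg S' :=
  LimAlg (lim_map_subproof x).

Fact lim_map_linear (c : R[i]) x y :
  lim_map_fun (c *: x + y) = c *: lim_map_fun x + lim_map_fun y.
Proof. by apply: lim_alg_inj => n; exact: hom_linear. Qed.

Fact lim_map_mul x y : lim_map_fun (x * y) = lim_map_fun x * lim_map_fun y.
Proof. by apply: lim_alg_inj => n; exact: hom_mul. Qed.

Fact lim_map_star x : lim_map_fun (star x) = star (lim_map_fun x).
Proof. by apply: lim_alg_inj => n; exact: hom_star. Qed.

Fact lim_map_continuous : continuous lim_map_fun.
Proof.
apply: continuous_lim => n x.
apply: (@continuous_comp _ _ _ (fun x : lim_alg S => x n) (d n)).
  exact: lim_at_continuous.
exact: hom_continuous.
Qed.

(* The inverse limit of the maps d_n. *)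
Definition lim_map : starHom (lim_alg S) (lim_alg S') :=
  StarHom lim_map_linear lim_map_mul lim_map_star lim_map_continuous.

End LimMap.

(* D is the comultiplication of a quantum group structure on A, given models
   AA, (AA)A, A(AA) of the tensor products A (x) A, (A (x) A) (x) A and
   A (x) (A (x) A) with their elementary tensors tAA, tl, tr. Below, F and G are
   D (x) id and id (x) D, which are determined by their values on elementary
   tensors, and assoc is the associativity isomorphism. In the last two clauses
   linear combinations reduce to sums, as b may be rescaled. *)
Definition is_comultiplication (R : realType)
    (A AA AA_A A_AA : topStarAlgType R)
    (tAA : A -> A -> AA) (tl : AA -> A -> AA_A) (tr : A -> AA -> A_AA)
    (D : starHom A AA) : Prop :=
  [/\ D 1 = 1,
      exists (F : starHom AA AA_A) (G : starHom AA A_AA)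
          (assoc : starHom AA_A A_AA),
        [/\ forall a b, F (tAA a b) = tl (D a) b,
            forall a b, G (tAA a b) = tr a (D b),
            forall a b c, assoc (tl (tAA a b) c) = tr a (tAA b c) &
            forall a, assoc (F (D a)) = G (D a)],
      dense [set x | exists s : seq (A * A),
        x = \sum_(p <- s) D p.1 * tAA p.2 1] &
      dense [set x | exists s : seq (A * A),
        x = \sum_(p <- s) D p.1 * tAA 1 p.2]].

Definition cstar_compact_qgroup (R : realType) (T : minTensor R)
    (A : cstarAlgType R) (D : starHom A (T A A)) : Prop :=
  is_comultiplication (tens (T A A)) (tens (T (T A A) A)) (tens (T A (T A A)))
    D.

Definition sigma_cstar_qgroup (R : realType) (T : minTensor R)
    (S : invSystem R) (D : starHom (lim_alg S) (lim_alg (tensor_sys T S S))) :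
    Prop :=
  is_comultiplication (@lim_tens R T S S)
    (@lim_tens R T (tensor_sys T S S) S) (@lim_tens R T S (tensor_sys T S S)) D.

Definition inversions (n : nat) (i : 'I_n -> 'I_n) : nat :=
  #|[set p : 'I_n * 'I_n | (p.1 < p.2)%N && (i p.2 < i p.1)%N]|.

Definition SUq_E (R : realType) (q : R) (n : nat) (i : {ffun 'I_n -> 'I_n}) :
    R[i] :=
  if injectiveb i then (- q%:C) ^+ inversions i else 0.

(* The relations between the generators of C(SU_q(n)); z and e stand for the
   generators called 0 and 1, which are not assumed to be the zero and the unit
   of B. *)
Record SUq_relations (R : realType) (q : R) (n : nat) (B : cstarAlgType R)
    (z e : B) (u : 'I_n -> 'I_n -> B) : Prop := {
  SUq_z : star z = z /\ z * z = z;
  SUq_e : star e = e /\ e * e = e;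
  SUq_ze : z * e = z /\ e * z = z;
  SUq_eu : forall i j, e * u i j = u i j /\ u i j * e = u i j;
  SUq_zu : forall i j, z * u i j = z /\ u i j * z = z;
  SUq_uustar : forall i j,
    \sum_(k < n) u i k * star (u j k) = if i == j then e else z;
  SUq_ustaru : forall i j,
    \sum_(k < n) star (u k i) * u k j = if i == j then e else z;
  SUq_det : forall j : {ffun 'I_n -> 'I_n},
    \sum_(i : {ffun 'I_n -> 'I_n}) SUq_E q i *: \prod_(k < n) u (j k) (i k)
      = SUq_E q j *: e
}.

(* A is the universal C*-algebra C(SU_q(n)), with generators z, e, u. *)
Definition is_C_SUq (R : realType) (q : R) (n : nat) (A : cstarAlgType R)
    (z e : A) (u : 'I_n -> 'I_n -> A) : Prop :=
  SUq_relations q z e u /\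
  forall (B : cstarAlgType R) (z' e' : B) (u' : 'I_n -> 'I_n -> B),
    SUq_relations q z' e' u' ->
    let maps_generators (f : starHom A B) :=
      [/\ f z = z', f e = e' & forall i j, f (u i j) = u' i j] in
    exists2 f : starHom A B, maps_generators f &
      forall g : starHom A B, maps_generators g -> g =1 f.

Definition is_SUq_comult (R : realType) (T : minTensor R) (n : nat)
    (A : cstarAlgType R) (z e : A) (u : 'I_n -> 'I_n -> A)
    (D : starHom A (T A A)) : Prop :=
  [/\ D z = tens (T A A) z z, D e = tens (T A A) e e &
      forall i j, D (u i j) = \sum_(k < n) tens (T A A) (u i k) (u k j)].

(* theta : C(SU_q(n.+1)) -> C(SU_q(n)) sends u_ij to u_ij if i, j are both among
   the first n indices, and to delta_ij 1 otherwise. *)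
Definition is_SUq_theta (R : realType) (n : nat) (A B : cstarAlgType R)
    (z e : A) (u : 'I_n.+1 -> 'I_n.+1 -> A)
    (z' e' : B) (u' : 'I_n -> 'I_n -> B) (theta : starHom A B) : Prop :=
  [/\ theta z = z', theta e = e',
      forall i j : 'I_n,
        theta (u (widen_ord (leqnSn n) i) (widen_ord (leqnSn n) j)) = u' i j &
      forall i j : 'I_n.+1, ~~ ((i < n)%N && (j < n)%N) ->
        theta (u i j) = if i == j then e' else z'].

(* Main.v *)
Require Import Defs.
From HB Require Import structures.
From mathcomp Require Import all_boot all_order all_algebra.
From mathcomp Require Import complex.
From mathcomp Require Import all_classical reals topology normedtype.
From mathcomp Require Import sequences.

(** At each level, the maps D (x) id, id (x) D and the associativity isomorphism
    of the compact quantum groups A_n are determined by their values on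
    elementary tensors, so they commute with the connecting maps and pass to the
    limit. (For the associativity map, which is tested on (a (x) b) (x) c, this
    requires x |-> x (x) c to be continuous; it is, since unital *-morphisms of
    C*-algebras are contractive.) A neighbourhood in the limit constrains a single level only, and the
    limit maps onto each A_n because the connecting maps are onto; hence the
    density conditions pass to the limit as well.

    For SU_q, multiplying a unitarity relation by the generator 0 forces this
    generator to vanish (as n >= 2). The two homomorphisms
    (theta (x) theta) Delta and Delta theta then agree on generators, hence
    everywhere by the uniqueness part of the universal property. *)

Set Implicit Arguments.
Unset Strict Implicit.
Unset Printing Implicit Defensive.

Import Order.TTheory GRing.Theory Num.Theory.
Import numFieldNormedType.Exports.
Local Open Scope ring_scope.
Local Open Scope classical_set_scope.
Local Open Scope complex_scope.

(** * Continuity and density in the norm topology *)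

Section CstarContinuity.
Context (R : realType) (A B : cstarAlgType R).

Lemma cnorm_continuousP (f : A -> B) : continuous f <->
  forall a (e : R), 0 < e -> exists2 d, 0 < d &
    forall b, cnorm (b - a) < d -> cnorm (f b - f a) < e.
Proof.
split=> [cf a e e0|H a U /cnorm_nbhs[e e0 eU]].
  have : nbhs (f a) [set b | cnorm (b - f a) < e] by apply/cnorm_nbhs; exists e.
  by move=> /cf /cnorm_nbhs.
apply/cnorm_nbhs; have [d d0 dP] := H a e e0.
by exists d => // b /dP; apply: eU.
Qed.

Lemma dense_eq (D : set A) (f g : A -> B) : dense D ->
  continuous f -> continuous g -> (forall a, D a -> f a = g a) -> f =1 g.
Proof.
move=> dD /cnorm_continuousP cf /cnorm_continuousP cg fg a.
apply/eqP; rewrite -subr_eq0; apply/eqP/cnorm_eq0/eqP.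
rewrite eq_le cnorm_ge0 andbT; apply/ler_addgt0Pr => e e0; rewrite add0r.
have e2 : 0 < e / 2 by rewrite divr_gt0.
have [d d0 dP] := cf a _ e2; have [d' d'0 d'P] := cg a _ e2.
have [|b Db] := @dense_approx _ _ D a (Num.min d d') dD.
  by rewrite lt_min d0 d'0.
rewrite lt_min => /andP[/dP fb /d'P gb].
rewrite (le_trans (cnorm_triangle _ (f b) _)) // [e]splitr lerD ?ltW //.
  by rewrite cnormB.
by rewrite fg.
Qed.

End CstarContinuity.

(** * Automatic continuity of unital star-morphisms *)

Section Contractive.
Context (R : realType).

Lemma normcR (r : R) : 0 <= r -> Normc.normc r%:C = r.
Proof.
by move=> r0; rewrite /Normc.normc /= expr0n addr0 sqrtr_sqr ger0_norm.
Qed.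

Lemma star0 (A : cstarAlgType R) : star 0 = 0 :> A.
Proof. by apply: (@addrI _ (star 0)); rewrite -starD !addr0. Qed.

Lemma star1 (A : cstarAlgType R) : star 1 = 1 :> A.
Proof. by rewrite -[LHS]mul1r -{1}(starK (1 : A)) -starM mul1r starK. Qed.

(** The C*-identity at 1 says that x = ||1|| satisfies x = x^2. *)
Lemma cnorm1_le (A : cstarAlgType R) : cnorm (1 : A) <= 1.
Proof.
have := cnorm_star (1 : A); rewrite star1 mulr1.
have := cnorm_ge0 (1 : A); set x := cnorm _; rewrite le_eqVlt.
case/predU1P => [<- _|x0 xx]; first exact: ler01.
by rewrite -(ler_pM2l x0) mulr1 -expr2 -xx.
Qed.

Lemma isometry_cnorm_le1 (A : cstarAlgType R) (v : A) :
  star v * v = 1 -> cnorm v <= 1.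
Proof.
move=> vv; rewrite -(@expr_le1 _ 2) ?cnorm_ge0 // -cnorm_star vv.
exact: cnorm1_le.
Qed.

Lemma cvg_mul (A : cstarAlgType R) (v w : nat -> A) (a b : A) :
  v @ \oo --> a -> w @ \oo --> b -> (fun n => v n * w n) @ \oo --> a * b.
Proof.
move=> va wb; apply: (@continuous2_cvg _ _ _ _ _ _ _ _ (fun a b : A => a * b)).
- exact: (@Defs.mul_continuous _ _ (a, b)).
- exact: va.
- exact: wb.
Qed.

Lemma cvg_add (A : cstarAlgType R) (v w : nat -> A) (a b : A) :
  v @ \oo --> a -> w @ \oo --> b -> (fun n => v n + w n) @ \oo --> a + b.
Proof.
move=> va wb; apply: (@continuous2_cvg _ _ _ _ _ _ _ _ (fun a b : A => a + b)).
- exact: (@add_continuous _ (a, b)).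
- exact: va.
- exact: wb.
Qed.

Lemma cstar_sqrt_1subsqr (A : cstarAlgType R) (h : A) :
  star h = h -> cnorm h < 1 ->
  exists k : A, [/\ star k = k, k * h = h * k & k * k = 1 - h * h].
Proof.
(* k = 1 - y for the fixed point y of the contraction y |-> (h^2 + y^2) / 2 *)
move=> hh h1; pose c : R[i] := (2^-1)%:C; pose r := cnorm h ^+ 2.
have r0 : 0 <= r by rewrite exprn_ge0 ?cnorm_ge0.
have r1 : r < 1 by rewrite /r expr_lt1 ?cnorm_ge0.
pose y := fun n => iter n (fun y : A => c *: (h * h + y * y)) 0.
have cZ (a : A) : cnorm (c *: a) = cnorm a / 2.
  by rewrite cnormZ normcR ?invr_ge0 // mulrC.
have c2 (a : A) : c *: a + c *: a = a.
  rewrite -scalerDl /c -rmorphD /= -[LHS]/(((2^-1 + 2^-1 : R)%:C) *: a).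
  by rewrite -[2^-1]mul1r -splitr scale1r.
(* The ball of radius r is stable: ||y|| <= r < 1 gives ||y^2|| <= r, and [c] averages this with
   ||h^2|| = r. *)
have yr n : cnorm (y n) <= r.
  elim: n => [|n IH] /=; first by rewrite cnorm0.
  rewrite cZ ler_pdivrMr // mulr_natr (le_trans (cnormD _ _)) // mulr2n.
  apply: lerD; first by rewrite -{1}hh cnorm_star.
  rewrite (le_trans (cnormM _ _)) // (le_trans _ IH) //.
  by rewrite ler_piMl ?cnorm_ge0 // (le_trans IH) // ltW.
(* Since a^2 - b^2 = a(a - b) + (a - b)b, each of the two terms gains a factor r, and halving their
   sum keeps that factor. *)
have ycauchy n p : cnorm (y (n + p)%N - y n) <= r ^+ n.
  elim: n => [|n IH].
    by rewrite add0n subr0 expr0 (le_trans (yr p)) // ltW.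
  rewrite addSn /= -scalerBr cZ ler_pdivrMr // opprD addrACA subrr add0r.
  move: IH; set a := y (n + p)%N; set b := y n => IH.
  have -> : a * a - b * b = a * (a - b) + (a - b) * b.
    by rewrite mulrBr mulrBl addrA subrK.
  rewrite (le_trans (cnormD _ _)) // mulr_natr mulr2n exprS.
  apply: lerD; rewrite (le_trans (cnormM _ _)) //.
    by rewrite ler_pM ?cnorm_ge0 ?yr.
  by rewrite mulrC ler_pM ?cnorm_ge0 ?yr.
have [l yl] : exists l : A, y @ \oo --> l.
  apply: cnorm_complete => e e0.
  have e2 : 0 < e / 2 by rewrite divr_gt0.
  have : r ^+ n @[n --> \oo] --> (0 : R) by apply: cvg_expr; rewrite ger0_norm.
  move=> /cvgrPdist_lt /(_ _ e2)[N _ NP]; exists N => m n Nm Nn.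
  have {NP} rN : r ^+ N < e / 2.
    have := NP N (leqnn N).
    by rewrite sub0r normrN ger0_norm // exprn_ge0.
  have yN k : (N <= k)%N -> cnorm (y k - y N) < e / 2.
    by move=> Nk; rewrite (le_lt_trans _ rN) // -(subnKC Nk) ycauchy.
  rewrite (le_lt_trans (cnorm_triangle _ (y N) _)) // [e]splitr ltrD ?yN //.
  by rewrite cnormB yN.
have ysa n : star (y n) = y n.
  elim: n => [|n IH] /=; first exact: star0.
  rewrite starZ starD !starM hh IH; congr (_ *: _).
  by apply: conj_Creal; apply/complex_realP; exists 2^-1.
have yh n : y n * h = h * y n.
  elim: n => [|n IH] /=; first by rewrite mul0r mulr0.
  rewrite -scalerAl -scalerAr mulrDl mulrDr -!mulrA IH.
  by rewrite !mulrA IH.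
(* The limit of 2 y_(n+1) = h^2 + y_n^2. *)
have ly : l + l = h * h + l * l.
  have yl1 : y \o S @ \oo --> l.
    apply/cvg_cnorm => e; move/cvg_cnorm: yl => /[apply] -[N NP].
    by exists N => n Nn; apply: NP; exact: leqW.
  apply: (@cnorm_cvg_unique _ _ (fun n => y n.+1 + y n.+1)).
    exact: cvg_add.
  rewrite (_ : (fun n => _) = fun n => h * h + y n * y n).
    by apply: cvg_add; [exact: cvg_cst|exact: cvg_mul].
  by apply/funext => n; rewrite /= c2.
have lsa : star l = l.
  apply: (@cnorm_cvg_unique _ _ (@star R A \o y)).
    by apply: continuous_cvg; [exact: star_continuous|].
  by rewrite (_ : _ \o _ = y) //; apply/funext => n; exact: ysa.
have lh : l * h = h * l.
  apply: (@cnorm_cvg_unique _ _ (fun n => y n * h)).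
    by apply: cvg_mul => //; exact: cvg_cst.
  rewrite (_ : (fun n => _) = fun n => h * y n); last exact/funext.
  by apply: cvg_mul => //; exact: cvg_cst.
exists (1 - l); split.
- by rewrite starD -scaleN1r starZ star1 lsa rmorphN1 scaleN1r.
- by rewrite mulrBl mulrBr mul1r mulr1 lh.
- rewrite mulrBl mul1r mulrBr mulr1 opprB [l * l - l]addrC addrA.
  by rewrite -(addrA 1) -opprD ly opprD addrA subrK.
Qed.

(* Self-adjoint h with ||h|| < 1 is the average of the unitaries h +- ik, where
   k^2 = 1 - h^2, and f maps unitaries to unitaries. *)
Lemma unital_starmorphism_le1 (A B : cstarAlgType R) (f : A -> B) (a : A) :
  (forall (c : R[i]) (a b : A), f (c *: a + b) = c *: f a + f b) ->
  {morph f : a b / a * b} -> {morph f : a / star a} -> f 1 = 1 ->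
  cnorm a < 1 -> cnorm (f a) <= 1.
Proof.
move=> flin fM fS f1.
have fD x y : f (x + y) = f x + f y.
  by have := flin 1 x y; rewrite !scale1r.
have unitary_le v : star v * v = 1 -> cnorm (f v) <= 1.
  by move=> vv; apply: isometry_cnorm_le1; rewrite -fS -fM vv.
have sa_le h : star h = h -> cnorm h < 1 -> cnorm (f h) <= 1.
  move=> hh h1; have [k [kk kh k2]] := cstar_sqrt_1subsqr hh h1.
  (* Used for c = i and c = -i: in (h - ck)(h + ck) the cross terms cancel because h and k commute,
     leaving h^2 + k^2 = 1. *)
  have uu (c : R[i]) : (c^* = - c)%R -> c * c = -1 ->
      star (h + c *: k) * (h + c *: k) = 1.
    move=> cc c2; rewrite starD starZ kk hh cc mulrDl !mulrDr.
    rewrite -!scalerAr -!scalerAl kh scalerA mulrN c2 opprK scale1r.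
    by rewrite k2 scaleNr addrA addrK addrC subrK.
  have le1 := unitary_le _ (uu 'i (conjCi _) (mulCii _)).
  have le2 : cnorm (f (h + (- 'i) *: k)) <= 1.
    by apply/unitary_le/uu; rewrite ?rmorphN /= ?conjCi // mulrNN mulCii.
  have e : f h + f h = f (h + 'i *: k) + f (h + (- 'i) *: k).
    by rewrite -!fD addrACA -scalerDl subrr scale0r addr0.
  have : cnorm (f h + f h) <= 1 + 1.
    by rewrite e (le_trans (cnormD _ _)) // lerD.
  have -> : f h + f h = (2 : R)%:C *: f h.
    by rewrite -mulr2n -scaler_nat; congr (_ *: _); rewrite rmorph_nat.
  by rewrite cnormZ normcR // -mulr2n -[leRHS]mulr1 ler_pM2l.
(* The C*-identity reduces an arbitrary a to the self-adjoint element [star a * a], whose norm is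
   still below 1. *)
move=> a1; rewrite -(@expr_le1 _ 2) ?cnorm_ge0 // -cnorm_star -fS -fM.
apply: sa_le; first by rewrite starM starK.
by rewrite cnorm_star expr_lt1 ?cnorm_ge0.
Qed.

(** Rescaling the bound on the open unit ball gives ||f x|| <= e/2 when ||x|| < e/2; the half
    restores a strict inequality. *)
Lemma unital_starmorphism_continuous (A B : cstarAlgType R) (f : A -> B) :
  (forall (c : R[i]) (a b : A), f (c *: a + b) = c *: f a + f b) ->
  {morph f : a b / a * b} -> {morph f : a / star a} -> f 1 = 1 ->
  continuous f.
Proof.
move=> flin fM fS f1; apply/cnorm_continuousP => a e e0.
exists (e / 2) => [|b]; first by rewrite divr_gt0.
have d0 : 0 < e / 2 by rewrite divr_gt0.
have fB : f b - f a = f (b - a).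
  by have := flin (-1) a b; rewrite !scaleN1r ![- _ + _]addrC => ->.
rewrite fB; move: (b - a) => x xd.
have f0 : f 0 = 0.
  by have := flin (-1) 0 0; rewrite !scaleN1r !addNr.
have fZ (c : R[i]) y : f (c *: y) = c *: f y.
  by have := flin c y 0; rewrite f0 !addr0.
have := @unital_starmorphism_le1 A B f ((e / 2)^-1%:C *: x) flin fM fS f1.
rewrite fZ !cnormZ normcR; last by rewrite invr_ge0 ltW.
rewrite ltr_pdivrMl // ler_pdivrMl // !mulr1 => /(_ xd).
by move=> /le_lt_trans; apply; rewrite ltr_pdivrMr // ltr_pMr // ltr1n.
Qed.

End Contractive.

(** * Homomorphisms on tensor products are determined by elementary tensors *)

Section TensorHom.
Context (R : realType) (A B : cstarAlgType R) (T : spatialTensor A B).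

Lemma hom_sum (C D : topStarAlgType R) (f : starHom C D) (I : Type)
    (s : seq I) (F : I -> C) :
  f (\sum_(i <- s) F i) = \sum_(i <- s) f (F i).
Proof. by apply: (big_morph f); [exact: homD|exact: hom0]. Qed.

Lemma tens_suml (I : Type) (s : seq I) (F : I -> A) (b : B) :
  tens T (\sum_(i <- s) F i) b = \sum_(i <- s) tens T (F i) b.
Proof.
apply: (big_morph (tens T ^~ b)) => [a a'|].
  by have := tens_linearl T b 1 a a'; rewrite !scale1r.
by have := tens_linearl T b (-1) 0 0; rewrite !scaleN1r !addNr.
Qed.

Lemma tens0l (b : B) : tens T 0 b = 0.
Proof. by have := tens_suml [::] (fun i : nat => 0) b; rewrite !big_nil. Qed.

Lemma tens0r (a : A) : tens T a 0 = 0.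
Proof. by have := tens_linearr T a (-1) 0 0; rewrite !scaleN1r !addNr. Qed.

(** Write a (x) b = (a (x) 1)(1 (x) b): the first factor is a unital star-morphism in a, hence
    continuous, and the second is constant. *)
Lemma tens_continuousl (b : B) : continuous (tens T ^~ b).
Proof.
have c1 : continuous (tens T ^~ 1).
  apply: unital_starmorphism_continuous.
  - by move=> c a a'; exact: tens_linearl.
  - by move=> a a'; rewrite tensM mulr1.
  - by move=> a; rewrite tens_star star1.
  - exact: tens1.
move=> a.
rewrite (_ : tens T ^~ b = fun a => tens T a 1 * tens T 1 b); last first.
  by apply/funext => a'; rewrite tensM mulr1 mul1r.
apply: (@continuous2_cvg _ _ _ _ _ _ _ _ (fun x y : T => x * y)).
- exact: (@Defs.mul_continuous _ _ (tens T a 1, tens T 1 b)).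
- exact: c1.
- exact: cvg_cst.
Qed.

Lemma tens_hom_eq (C : cstarAlgType R) (f g : starHom T C) :
  (forall a b, f (tens T a b) = g (tens T a b)) -> f =1 g.
Proof.
move=> fg; apply: (dense_eq (@tens_dense _ _ _ T)).
- exact: hom_continuous.
- exact: hom_continuous.
- by move=> _ [s ->]; rewrite !hom_sum; apply: eq_bigr => p _.
Qed.

End TensorHom.

Lemma tens_tens_hom_eq (R : realType) (A B C D : cstarAlgType R)
    (T : spatialTensor A B) (T' : spatialTensor T C) (f g : starHom T' D) :
  (forall a b c, f (tens T' (tens T a b) c) = g (tens T' (tens T a b) c)) ->
  f =1 g.
Proof.
move=> fg; apply: tens_hom_eq => x c; move: x.
have cc (h : starHom T' D) : continuous (fun x => h (tens T' x c)).
  move=> x; apply: (@continuous_comp _ _ _ (tens T' ^~ c) h).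
    exact: tens_continuousl.
  exact: hom_continuous.
apply: (dense_eq (@tens_dense _ _ _ T)) => [||_ [s ->]]; try exact: cc.
by rewrite tens_suml !hom_sum; apply: eq_bigr => p _.
Qed.

(** * Projections and neighbourhoods of an inverse limit *)

Section LimTopology.
Context (R : realType).

(** Entries above level n are preimages chosen recursively; those below are images under the
    connecting maps. Induction on n drops level 0 of the system, so that the recursive choice always
    starts at level 0. *)
Lemma lim_at_surj (S : invSystem R) n (y : S n) :
  (forall k (y : S k), exists x : S k.+1, sys_map S k x = y) ->
  exists x : lim_alg S, x n = y.
Proof.
elim: n S y => [|n IH] S y Ssurj.
  pose lift k y := projT1 (cid (Ssurj k y)).
  pose x := fix x n : S n :=
    if n is k.+1 then lift k (x k) else y.
  have xP k : sys_map S k (x k.+1) = x k by exact: projT2 (cid (Ssurj k (x k))).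
  by exists (LimAlg xP).
pose S1 := @InvSystem R (fun k => S k.+1) (fun k => sys_map S k.+1)
  (fun k => sys_map1 S k.+1).
have [x xy] := IH S1 y (fun k => Ssurj k.+1).
pose x0 k : S k := if k is k.+1 then x k else sys_map S 0 (x 0%N).
have x0P k : sys_map S k (x0 k.+1) = x0 k.
  by case: k => // k; exact: (lim_atP x k).
by exists (LimAlg x0P).
Qed.

Definition lim_nbhd (S : invSystem R) (x : lim_alg S) n (e : R) :
    set (lim_alg S) :=
  [set y | cnorm (y n - x n) < e].

(** By continuity of the connecting maps, a constraint at one level follows from one at any higher
    level; this allows finitely many constraints to be merged into one. *)
Lemma lim_nbhd_le (S : invSystem R) (x : lim_alg S) n m (e : R) :
  (n <= m)%N -> 0 < e ->
  exists2 d, 0 < d & lim_nbhd x m d `<=` lim_nbhd x n e.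
Proof.
elim: m e => [|m IH] e; first by rewrite leqn0 => /eqP-> e0; exists e.
rewrite leq_eqVlt ltnS => /predU1P[->|nm] e0; first by exists e.
have [d d0 dP] := IH e nm e0.
have /cnorm_continuousP/(_ (x m.+1) d d0)[d' d'0 d'P] :=
  @hom_continuous _ _ _ (sys_map S m).
exists d' => // y /d'P yx; apply: dP.
by move: yx; rewrite !lim_atP.
Qed.

Lemma lim_nbhsP (S : invSystem R) (x : lim_alg S) (U : set (lim_alg S)) :
  nbhs x U -> exists n e, 0 < e /\ lim_nbhd x n e `<=` U.
Proof.
pose w y := @lim_at R S y : prod_topology (fun n => S n).
(* The filter on the product generated by the images under [w] of the one-level neighbourhoods of x.
   It converges to [w x] in each coordinate, hence in the product, so it contains every open set
   around [w x]. *)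
pose F : set_system (prod_topology (fun n => S n)) := fun V =>
  exists n e, 0 < e /\ forall y, lim_nbhd x n e y -> V (w y).
have FF : Filter F.
  split.
  - by exists 0%N, 1.
  - move=> P Q [n [e [e0 eP]]] [m [d [d0 dQ]]].
    have [e1 e10 e1P] := lim_nbhd_le x (leq_maxl n m) e0.
    have [d1 d10 d1P] := lim_nbhd_le x (leq_maxr n m) d0.
    exists (maxn n m), (Num.min e1 d1); split; first by rewrite lt_min e10 d10.
    move=> y; rewrite /lim_nbhd /= lt_min => /andP[/e1P/eP ? /d1P/dQ ?].
    by split.
  - move=> P Q PQ [n [e [e0 eP]]]; exists n, e; split => // y /eP; exact: PQ.
rewrite nbhsE => -[O [[V oV <-] Vx] VU].
have : F V.
  have : F --> w x.
    apply/cvg_sup => n W; rewrite nbhsE => -[_ [[V' oV' <-] V'x] V'W].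
    have /cnorm_nbhs[e e0 eV'] : nbhs (x n) V' by exact: open_nbhs_nbhs.
    by exists n, e; split => // y yx; apply: V'W; exact: eV'.
  by apply; exact: open_nbhs_nbhs.
by move=> [n [e [e0 eV]]]; exists n, e; split => // y /eV; exact: VU.
Qed.

Lemma lim_dense (S : invSystem R) (D : set (lim_alg S)) :
  (forall n, dense ((fun x => x n : S n) @` D)) -> dense D.
Proof.
move=> dD O [x Ox] oO.
have /lim_nbhsP[n [e [e0 eO]]] : nbhs x O by exact: open_nbhs_nbhs.
have [_ [y Dy <-] yx] := dense_approx (x n) (dD n) e0.
by exists y; split => //; exact: eO.
Qed.

End LimTopology.

(** * Composition of star-homomorphisms *)

Section HomComp.
Context (R : realType) (A B C : topStarAlgType R).
Context (g : starHom B C) (f : starHom A B).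

Fact hom_comp_linear (c : R[i]) a b :
  g (f (c *: a + b)) = c *: g (f a) + g (f b).
Proof. by rewrite !hom_linear. Qed.
Fact hom_comp_mul a b : g (f (a * b)) = g (f a) * g (f b).
Proof. by rewrite !hom_mul. Qed.
Fact hom_comp_star a : g (f (star a)) = star (g (f a)).
Proof. by rewrite !hom_star. Qed.
Fact hom_comp_continuous : continuous (fun a => g (f a)).
Proof.
by move=> a; apply: (@continuous_comp _ _ _ f g); exact: hom_continuous.
Qed.

Definition hom_comp : starHom A C :=
  @StarHom R A C (fun a => g (f a)) hom_comp_linear hom_comp_mul
    hom_comp_star hom_comp_continuous.

End HomComp.

(** * The generators of C(SU_q(n)) and the connecting maps *)

Section SUqGenerators.
Context (R : realType) (q : R).

Lemma SUq_relations_hom n (A B : cstarAlgType R) (z e : A) u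
    (f : starHom A B) : f 1 = 1 ->
  @SUq_relations R q n A z e u ->
  SUq_relations q (f z) (f e) (fun i j => f (u i j)).
Proof.
move=> f1 [z1 e1 ze eu zu uu1 uu2 det].
(* A [starHom] need not be unital; [f 1 = 1] covers the empty product. *)
have prodE (I : finType) (F : I -> A) : f (\prod_i F i) = \prod_i f (F i).
  by apply: (big_morph f); [exact: hom_mul|].
split.
- by rewrite -hom_star -hom_mul z1.1 z1.2.
- by rewrite -hom_star -hom_mul e1.1 e1.2.
- by rewrite -!hom_mul ze.1 ze.2.
- by move=> i j; rewrite -!hom_mul (eu i j).1 (eu i j).2.
- by move=> i j; rewrite -!hom_mul (zu i j).1 (zu i j).2.
- move=> i j; rewrite -(fun_if f) -uu1 hom_sum; apply: eq_bigr => k _.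
  by rewrite hom_mul hom_star.
- move=> i j; rewrite -(fun_if f) -uu2 hom_sum; apply: eq_bigr => k _.
  by rewrite hom_mul hom_star.
- move=> j; rewrite -homZ -det hom_sum; apply: eq_bigr => i _.
  by rewrite homZ prodE.
Qed.

(** The images of the generators under f satisfy the relations, so the universal property yields one
    homomorphism h with these values, and its uniqueness identifies both f and g with h. *)
Lemma SUq_hom_ext n (A B : cstarAlgType R) (z e : A) u (f g : starHom A B) :
  @is_C_SUq R q n A z e u -> f 1 = 1 -> f z = g z -> f e = g e ->
  (forall i j, f (u i j) = g (u i j)) -> f =1 g.
Proof.
move=> [rel univ] f1 fz fe fu.
have [h _ hP] := univ _ _ _ _ (SUq_relations_hom f1 rel).
have fh : f =1 h by apply: hP.
have gh : g =1 h by apply: hP; split=> [||i j]; rewrite ?fz ?fe ?fu.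
by move=> a; rewrite fh gh.
Qed.

(* Multiplying sum_k u_ik u_ik^* = e by z gives n z = z. *)
Lemma SUq_z_eq0 n (A : cstarAlgType R) (z e : A) u :
  @SUq_relations R q n.+2 A z e u -> z = 0.
Proof.
move=> [[z1 _] _ [ze _] _ zu uu _ _].
have zus i j : z * star (u i j) = z.
  by rewrite -{1}z1 -starM (zu i j).2.
have := congr1 ( *%R z) (uu ord0 ord0); rewrite ze mulr_sumr.
rewrite (eq_bigr (fun=> z)) => [|k _]; last by rewrite mulrA (zu _ _).1.
(* With n + 2 indices the equation reads (n + 2) z = z; cancelling one z leaves (n + 1) z = 0 with a
   nonzero factor. *)
rewrite sumr_const card_ord mulrSr => /(canRL (addrK _)); rewrite subrr.
move/eqP; rewrite -scaler_nat scaler_eq0 pnatr_eq0 /= => /eqP //.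
Qed.

Lemma SUq_theta_comult n (T : minTensor R) (A B : cstarAlgType R) (zA eA : A)
    uA (zB eB : B) uB (DA : starHom A (T A A)) (DB : starHom B (T B B))
    (theta : starHom A B) :
  @is_C_SUq R q n.+3 A zA eA uA -> @SUq_relations R q n.+2 B zB eB uB ->
  is_SUq_comult zA eA uA DA -> is_SUq_comult zB eB uB DB ->
  is_SUq_theta zA eA uA zB eB uB theta ->
  DA 1 = 1 -> theta 1 = 1 ->
  forall x, tensor_map (T A A) (T B B) theta theta (DA x) = DB (theta x).
Proof.
move=> univ relB [_ De' Du'] [_ De Du] [_ te tu td] D1 t1.
(* Once the generators called 0 are true zeros, a tensor vanishes as soon as one factor is an
   off-diagonal value of [theta] outside the block. *)
have zA0 : zA = 0 by have [rel _] := univ; exact: SUq_z_eq0 rel.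
have zB0 : zB = 0 by exact: SUq_z_eq0 relB.
apply: (SUq_hom_ext (f := hom_comp (tensor_map _ _ theta theta) DA)
  (g := hom_comp DB theta) univ) => /=.
- by rewrite D1 tensor_map1.
- by rewrite zA0 !hom0.
- by rewrite De' tensor_mapE te De.
(* The summand at the last index is split off; the others run over the indices of B. *)
- move=> i j; rewrite Du' hom_sum big_ord_recr /= tensor_mapE.
  rewrite (eq_bigr (fun l : 'I_n.+2 => tens (T B B)
    (theta (uA i (widen_ord (leqnSn _) l)))
    (theta (uA (widen_ord (leqnSn _) l) j)))); last first.
    by move=> l _; rewrite tensor_mapE.
  have [ilt|ige] := ltnP i n.+2; have [jlt|jge] := ltnP j n.+2.
  (* Both indices in the block: the last summand has the factor theta(u_i,last) = 0. *)
  + have -> : i = widen_ord (leqnSn _) (Ordinal ilt) by exact: val_inj.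
    have -> : j = widen_ord (leqnSn _) (Ordinal jlt) by exact: val_inj.
    rewrite tu Du; rewrite td /= ?ltnn ?andbF //.
    rewrite -val_eqE /= ltn_eqF // zB0 tens0l addr0.
    by apply: eq_bigr => l _; rewrite !tu.
  (* Only j is last: the right factor vanishes in the sum over the block, the left one in the last
     summand. The next case is symmetric. *)
  + rewrite [in RHS]td ?[(j < _)%N]ltnNge ?jge ?andbF //.
    rewrite [i == j]negbTE; last by rewrite -val_eqE neq_ltn (leq_trans ilt).
    rewrite zB0 hom0 big1 => [|l _]; last first.
      rewrite [X in tens _ _ X]td ?[(j < _)%N]ltnNge ?jge ?andbF //.
      rewrite ifF ?zB0 ?tens0r //.
      by apply/negbTE; rewrite -val_eqE neq_ltn /= (leq_trans (ltn_ord l)).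
    rewrite td /= ?ltnn ?andbF // ifF ?zB0 ?tens0l ?addr0 //.
    by apply/negbTE; rewrite -val_eqE neq_ltn ilt.
  + rewrite [in RHS]td ?[(i < _)%N]ltnNge ?ige //.
    rewrite [i == j]negbTE; last first.
      by rewrite -val_eqE neq_ltn (leq_trans jlt) ?orbT.
    rewrite zB0 hom0 big1 => [|l _]; last first.
      rewrite [X in tens _ X _]td ?[(i < _)%N]ltnNge ?ige //.
      rewrite ifF ?zB0 ?tens0l //.
      apply/negbTE; rewrite -val_eqE neq_ltn /=.
      by rewrite (leq_trans (ltn_ord l)) ?orbT.
    rewrite [X in tens _ _ X]td /= ?ltnn // ifF ?zB0 ?tens0r ?addr0 //.
    by apply/negbTE; rewrite -val_eqE neq_ltn jlt orbT.
  (* Both indices are last: only the last summand e (x) e survives, and it is [DB eB]. *)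
  + have -> : i = ord_max.
      by apply/val_inj/eqP; rewrite eqn_leq /= ige -ltnS ltn_ord.
    have -> : j = ord_max.
      by apply/val_inj/eqP; rewrite eqn_leq /= jge -ltnS ltn_ord.
    rewrite td /= ?ltnn // eqxx De big1 ?add0r // => l _.
    rewrite td /= ?ltnn // ifF ?zB0 ?tens0l //.
    by apply/negbTE; rewrite -val_eqE neq_ltn /= ltn_ord orbT.
Qed.

End SUqGenerators.

(** * Passing the quantum group axioms to the limit *)

Lemma lim_at_sum (R : realType) (S : invSystem R) n (I : Type)
    (s : seq I) (F : I -> lim_alg S) :
  (\sum_(i <- s) F i) n = \sum_(i <- s) F i n.
Proof. exact: (big_morph (fun x : lim_alg S => x n)). Qed.

Lemma dense_sub (X : topologicalType) (D E : set X) :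
  D `<=` E -> dense D -> dense E.
Proof.
by move=> DE dD O O0 oO; have [x [Ox Dx]] := dD O O0 oO; exists x; split;
  [|exact: DE].
Qed.

Lemma lim_sigma_cstar_qgroup (R : realType) (T : minTensor R)
    (S : invSystem R) (D : forall k, starHom (S k) (T (S k) (S k)))
    (hD : sys_morphism (S' := tensor_sys T S S) D) :
  (forall k, cstar_compact_qgroup (D k)) ->
  (forall k (y : S k), exists x : S k.+1, sys_map S k x = y) ->
  sigma_cstar_qgroup (lim_map hD).
Proof.
move=> qgroup Ssurj.
pose SS := tensor_sys T S S.
pose coassoc_at k (F : starHom (SS k) (T (SS k) (S k)))
    (G : starHom (SS k) (T (S k) (SS k)))
    (assoc : starHom (T (SS k) (S k)) (T (S k) (SS k))) :=
  [/\ forall a b, F (tens (T _ _) a b) = tens (T _ _) (D k a) b,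
      forall a b, G (tens (T _ _) a b) = tens (T _ _) a (D k b),
      forall a b c, assoc (tens (T _ _) (tens (T _ _) a b) c)
        = tens (T _ _) a (tens (T _ _) b c) &
      forall a, assoc (F (D k a)) = G (D k a)].
(* Choice turns the existence statement at each level into data, so that the maps form families
   indexed by k. *)
have coassoc k : {F & {G & {assoc | @coassoc_at k F G assoc}}}.
  case: (qgroup k) => _ /cid[F /cid[G /cid[assoc P]]] _ _.
  by exists F, G, assoc.
pose F k := projT1 (coassoc k); pose G k := projT1 (projT2 (coassoc k)).
pose assoc k := projT1 (projT2 (projT2 (coassoc k))).
have P k : @coassoc_at k (F k) (G k) (assoc k).
  exact: projT2 (projT2 (projT2 (coassoc k))).
have FE k : forall a b, _ := let: And4 h _ _ _ := P k in h.
have GE k : forall a b, _ := let: And4 _ h _ _ := P k in h.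
have assocE k : forall a b c, _ := let: And4 _ _ h _ := P k in h.
have assocFG k : forall a, _ := let: And4 _ _ _ h := P k in h.
have hF : sys_morphism (S := SS) (S' := tensor_sys T SS S) F.
  move=> k; apply: (tens_hom_eq (f := hom_comp (sys_map (tensor_sys T SS S) k)
    (F k.+1)) (g := hom_comp (F k) (sys_map SS k))) => a b /=.
  by rewrite FE !tensor_mapE FE (hD k).
have hG : sys_morphism (S := SS) (S' := tensor_sys T S SS) G.
  move=> k; apply: (tens_hom_eq (f := hom_comp (sys_map (tensor_sys T S SS) k)
    (G k.+1)) (g := hom_comp (G k) (sys_map SS k))) => a b /=.
  by rewrite GE !tensor_mapE GE (hD k).
(* The values of [assoc] are known only on (a (x) b) (x) c, hence the criterion for threefold
   tensors. *)
have hassoc : sys_morphism (S := tensor_sys T SS S)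
    (S' := tensor_sys T S SS) assoc.
  move=> k; apply: (tens_tens_hom_eq
    (f := hom_comp (sys_map (tensor_sys T S SS) k) (assoc k.+1))
    (g := hom_comp (assoc k) (sys_map (tensor_sys T SS S) k))) => a b c /=.
  by rewrite assocE !tensor_mapE assocE.
(* A section [l] of the projection to level n lifts each pair, so every element of the dense span at
   level n is the projection of one in the limit. *)
have lift n (s : seq (S n * S n)) : exists s' : seq (lim_alg S * lim_alg S),
    s = [seq (p.1 n, p.2 n) | p : lim_alg S * lim_alg S <- s'].
  have [l lE] := choice (fun y : S n => lim_at_surj y Ssurj).
  exists [seq (l p.1, l p.2) | p <- s]; rewrite -map_comp -[LHS]map_id.
  by apply: eq_map => -[a b] /=; rewrite !lE.
split.
- by apply: lim_alg_inj => k; have [D1 _ _ _] := qgroup k.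
- exists (lim_map hF), (lim_map hG), (lim_map hassoc); split.
  + by move=> a b; apply: lim_alg_inj => k; exact: FE.
  + by move=> a b; apply: lim_alg_inj => k; exact: GE.
  + by move=> a b c; apply: lim_alg_inj => k; exact: assocE.
  + by move=> a; apply: lim_alg_inj => k; exact: assocFG.
- apply: lim_dense => n.
  have [_ _ dD _] := qgroup n; apply: dense_sub dD => _ [s ->].
  have [s' ->] := lift n s.
  exists (\sum_(p <- s') lim_map hD p.1 * lim_tens T p.2 1); first by exists s'.
  by rewrite lim_at_sum big_map.
- apply: lim_dense => n.
  have [_ _ _ dD] := qgroup n; apply: dense_sub dD => _ [s ->].
  have [s' ->] := lift n s.
  exists (\sum_(p <- s') lim_map hD p.1 * lim_tens T 1 p.2); first by exists s'.
  by rewrite lim_at_sum big_map.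
Qed.

(* S k is C(SU_q(k + 2)), with generators z k, e k (called 0 and 1) and u k i j,
   and sys_map S k is theta_(k + 3); S is an inverse system of unital
   C*-algebras and unital *-homomorphisms. *)
Theorem mainTheorem1 (R : realType) (q : R) (T : minTensor R)
  (S : invSystem R) (z e : forall k, S k)
  (u : forall k, 'I_k.+2 -> 'I_k.+2 -> S k)
  (Delta : forall k, starHom (S k) (T (S k) (S k))) :
  0 < q -> q < 1 ->
  (forall k, is_C_SUq q (z k) (e k) (@u k)) ->
  (forall k, is_SUq_comult (z k) (e k) (@u k) (Delta k)) ->
  (forall k, cstar_compact_qgroup (Delta k)) ->
  (forall k, is_SUq_theta (z k.+1) (e k.+1) (@u k.+1) (z k) (e k) (@u k)
               (sys_map S k)) ->
  (forall k (y : S k), exists x : S k.+1, sys_map S k x = y) ->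
  exists hDelta : sys_morphism (S' := tensor_sys T S S) Delta,
    sigma_cstar_qgroup (lim_map hDelta).
Proof.
move=> _ _ univ comult qgroup theta Ssurj.
have hDelta : sys_morphism (S' := tensor_sys T S S) Delta.
  move=> k; have [relk _] := univ k; have [D1 _ _ _] := qgroup k.+1.
  apply: (SUq_theta_comult (univ k.+1) relk (comult _) (comult _) (theta k)).
  - exact: D1.
  - exact: sys_map1.
by exists hDelta; exact: lim_sigma_cstar_qgroup.
Qed.
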